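(* For $x\in(0,\sqrt{27/4})$ put $z=4x^2/27$. Then \[ V_{3/2,-1/2}(x)=\frac{\left(1+\sqrt{1-z}\right)^{2/3}}{3\pi\sqrt{3(1-z)}}z^{-1/3}+\frac{\left(1+\sqrt{1-z}\right)^{-2/3}}{3\pi\sqrt{3(1-z)}}z^{1/3}, \] \[ V_{3/2,0}(x)=\frac{\left(1+\sqrt{1-z}\right)^{1/3}}{3\pi\sqrt{1-z}}z^{-1/6}+\frac{\left(1+\sqrt{1-z}\right)^{-1/3}}{3\pi\sqrt{1-z}}z^{1/6}, \] \[ V_{3/2,1/2}(x)=\frac{\left(1+\sqrt{1-z}\right)^{1/3}}{\pi\sqrt{3(1-z)}}z^{1/3}+\frac{\left(1+\sqrt{1-z}\right)^{-1/3}}{\pi\sqrt{3(1-z)}}z^{2/3}. \]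
   Context: For $a\in\mathbb{R}$ and $n\in\{0,1,2,\ldots\}$, $\binom{a}{n}:=a(a-1)\cdots(a-n+1)/n!$. For rational $p>1$ and $-1<r\le p-1$ there is a unique probability measure $\nu(p,r)$ with moments $\int x^n\,d\nu(p,r)(x)=\binom{np+r}{n}$, $n\ge0$; it is absolutely continuous and supported on $[0,c(p)]$, $c(p)=p^p(p-1)^{1-p}$ (so $c(3/2)=\sqrt{27/4}$). $V_{p,r}$ denotes its (continuous on $(0,c(p))$) density. *)

(* Defs.v *)
From mathcomp Require Import all_boot all_order all_algebra.
From mathcomp Require Import all_classical all_reals all_analysis.

Set Implicit Arguments.
Unset Strict Implicit.
Unset Printing Implicit Defensive.

Import Order.TTheory GRing.Theory Num.Theory.
Import numFieldNormedType.Exports.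

Local Open Scope classical_set_scope.
Local Open Scope ring_scope.

Definition gbinom (R : realType) (a : R) (n : nat) : R :=
  (\prod_(i < n) (a - i%:R)) / n`!%:R.

Definition has_binomial_moments (R : realType) (p r : R)
    (mu : probability (measurableTypeR R) R) : Prop :=
  forall n : nat,
    mu.-integrable [set: R] (fun x : R => (x ^+ n)%:E) /\
    (\int[mu]_x (x ^+ n)%:E = (gbinom (n%:R * p + r) n)%:E)%E.

(* Meaningful only when there is exactly one such measure, in particular for
   p > 1 rational and -1 < r <= p - 1; otherwise an unspecified probability. *)
Definition nu (R : realType) (p r : R) : probability (measurableTypeR R) R :=
  get [set mu | has_binomial_moments p r mu].

Definition cmax (R : realType) (p : R) : R := p `^ p * (p - 1) `^ (1 - p).

Definition is_density (R : realType) (mu : probability (measurableTypeR R) R)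
    (f : R -> R) : Prop :=
  [/\ measurable_fun [set: R] f,
      forall x, 0 <= f x &
      forall A : set R, measurable A ->
        (mu A = \int[lebesgue_measure]_(x in A) (f x)%:E)%E].

(* A version of the density that is continuous on ]0, c(p)[; this determines
   its values on that interval, but not at the other points. *)
Definition V (R : realType) (p r : R) : R -> R :=
  get [set f | is_density (nu p r) f /\ {in `]0, cmax p[, continuous f}].

(* Main.v *)
(** The candidate density on ]0, c[, with c = 3 sqrt 3 / 2, is pulled back along
    x = 3 sqrt 3 w^3 / (1 + w^6), an increasing map of [0, 1] onto [0, c]. There
    sqrt z = 2 w^3 / (1 + w^6) and sqrt (1 - z) = (1 - w^6) / (1 + w^6), so that
    (1 + sqrt (1 - z)) / sqrt z = w^-3: all fractional powers disappear and the
    n-th moment becomes the integral over [0, 1] of the rational function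
    w^(3n) (w^e + w^(4-e)) / (1 + w^6)^(n+1), with e = 1 for r = 0 and e = 0 for
    r = -1/2. Integration by parts turns (n, e) into (n + 1, 1 - e), matching the
    recurrences of the binomial coefficients; the case n = 0 is an arctangent.
    The case r = 1/2 follows from r = 0, since (2/3) x V_(3/2,0)(x) has moments
    (2/3) binom(3(n+1)/2, n+1) = binom(3n/2 + 1/2, n).

    A probability measure with the moments of a compactly supported one is equal
    to it: the growth of the moments bounds its support, and the polynomials
    (1 - y^n)^(n ceil(b^-n)) converge boundedly on [0, 1] to the indicator of
    [0, b[, so dominated convergence recovers the distribution function. *)

From HB Require Import structures.
Require Import Defs.
From mathcomp Require Import all_boot all_order all_algebra.
From mathcomp Require Import all_classical all_reals all_analysis.
From mathcomp Require Import measurable_realfun ring lra.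

Import Order.TTheory GRing.Theory Num.Theory.
Import numFieldNormedType.Exports.

Local Open Scope ring_scope.

(** * Determinacy of the moment problem *)

Section cutoff.
Local Open Scope classical_set_scope.
Context {R : realType}.
Implicit Types b y : R.

Lemma bernoulli_ineq (t : R) n : -1 <= t -> 1 + n%:R * t <= (1 + t) ^+ n.
Proof.
move=> t1; elim: n => [|n IH]; first by rewrite mul0r addr0 expr0.
rewrite exprS; apply: (@le_trans _ _ ((1 + t) * (1 + n%:R * t))); last first.
  by rewrite ler_wpM2l//; lra.
by rewrite -natr1; have := sqr_ge0 t; have : 0 <= n%:R :> R by []; nra.
Qed.

(** Bernoulli's inequality at t = 1/z - 1 gives n (1/z - 1) <= z^-n. *)
Lemma natmul_expr_bound (z : R) n : 0 < z < 1 -> n%:R * z ^+ n <= (z^-1 - 1)^-1.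
Proof.
move=> /andP[z0 z1].
have zV1 : 0 < z^-1 - 1 by rewrite subr_gt0 invf_gt1.
have := @bernoulli_ineq (z^-1 - 1) n.
rewrite [1 + (_ - _)]addrC subrK => /(_ ltac:(lra)).
rewrite exprVn => h.
rewrite -ler_pdivlMr ?exprn_gt0// ler_pdivlMl//.
by rewrite mulrC; apply: le_trans h; lra.
Qed.

(** With s = sqrt z, the sequence factors as (n s^n) s^n, a bounded factor times a null one. *)
Lemma cvg_natmul_expr (z : R) : 0 <= z < 1 -> (n%:R * z ^+ n) @[n --> \oo] --> (0 : R).
Proof.
move=> /andP[z0 z1].
have [->|zn0] := eqVneq z 0.
  apply: cvg_near_cst; near=> n; rewrite expr0n; case: eqP => [->|]; last by rewrite mulr0.
  by rewrite mul0r.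
pose s := Num.sqrt z.
have zs : z = s * s by rewrite -expr2 sqr_sqrtr.
have s0 : 0 < s by rewrite sqrtr_gt0 lt_neqAle eq_sym zn0.
have s1 : s < 1 by nra.
apply: (@squeeze_cvgr _ _ _ _ (fun=> 0) (fun n => (s^-1 - 1)^-1 * s ^+ n)).
- near=> n; rewrite mulr_ge0 ?exprn_ge0//= zs exprMn mulrA ler_wpM2r ?exprn_ge0 ?(ltW s0)//.
  by apply: natmul_expr_bound; rewrite s0.
- exact: cvg_cst.
- rewrite -[X in _ --> X](mulr0 (s^-1 - 1)^-1); apply: cvgM; first exact: cvg_cst.
  by apply: cvg_expr; rewrite ger0_norm ?ltW.
Unshelve. all: end_near. Qed.

(* The factor n makes the limit at y = b equal to 0, so that b may be an atom. *)
Definition cutoff_exp b n : nat := (n * (Num.truncn (b ^- n)).+1)%N.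
Definition cutoff b n : {poly R} := (1 - 'X^n) ^+ cutoff_exp b n.

Lemma horner_cutoff b n y : (cutoff b n).[y] = (1 - y ^+ n) ^+ cutoff_exp b n.
Proof. by rewrite /cutoff !hornerE. Qed.

Lemma cutoff_ge0_le1 b n y : 0 <= y <= 1 -> 0 <= (cutoff b n).[y] <= 1.
Proof.
move=> /andP[y0 y1]; rewrite horner_cutoff.
have h0 : 0 <= y ^+ n by exact: exprn_ge0.
have h1 : y ^+ n <= 1 by exact: exprn_ile1.
by rewrite exprn_ge0 ?exprn_ile1//; lra.
Qed.

(** Let m be the exponent and t = y^n. If y < b, Bernoulli gives 1 - m t as a lower bound, and m <=
    n (b^-n + 1) makes m t at most n (y/b)^n + n y^n, which tends to 0. If y >= b, then m t >= n,
    and (1 - t)^m (1 + t)^m <= 1 with (1 + t)^m >= 1 + m t bounds the value by 1/n. *)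
Lemma cvg_cutoff b y : 0 < b <= 1 -> 0 <= y <= 1 ->
  (cutoff b n).[y] @[n --> \oo] --> ((y < b)%R%:R : R).
Proof.
move=> /andP[b0 b1] y01; have /andP[y0 y1] := y01.
have bV n : 0 <= b ^- n by rewrite invr_ge0 exprn_ge0 ?ltW.
case: ltP => yb.
- apply: (@squeeze_cvgr _ _ _ _
    (fun n => 1 - (n%:R * (y / b) ^+ n + n%:R * y ^+ n)) (fun=> 1)).
  + near=> n; have /andP[_ ->] := cutoff_ge0_le1 b n _ y01; rewrite andbT.
    have h0 : 0 <= y ^+ n by exact: exprn_ge0.
    have h1 : y ^+ n <= 1 by exact: exprn_ile1.
    rewrite horner_cutoff; apply: le_trans ((@bernoulli_ineq (- y ^+ n) _ _)); last by lra.
    rewrite mulrN lerD2l lerN2 /cutoff_exp natrM -mulrA -mulrDr ler_wpM2l//.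
    rewrite expr_div_n -natr1 mulrDl mul1r lerD2r mulrC ler_wpM2l//.
    by have /andP[] := truncn_itv (bV n).
  + rewrite -[X in _ --> X]subr0 -[in X in _ --> X](addr0 0).
    apply: cvgB; first exact: cvg_cst.
    apply: cvgD; apply: cvg_natmul_expr.
      by rewrite divr_ge0 ?(ltW b0)//= ltr_pdivrMr// mul1r.
    by rewrite y0 (lt_le_trans yb).
  + exact: cvg_cst.
- apply: (@squeeze_cvgr _ _ _ _ (fun=> 0) (fun n => n%:R^-1)).
  + near=> n; have /andP[-> _] /= := cutoff_ge0_le1 b n _ y01.
    have n0 : 0 < n%:R :> R by rewrite ltr0n; near: n; exact: nbhs_infty_gt.
    rewrite horner_cutoff; set t := y ^+ n; set m := cutoff_exp b n.
    have t0 : 0 <= t by exact: exprn_ge0.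
    have t1 : t <= 1 by exact: exprn_ile1.
    have q0 : 0 <= (1 - t) ^+ m by rewrite exprn_ge0// subr_ge0.
    have mt : n%:R <= m%:R * t.
      rewrite /m /cutoff_exp natrM -mulrA ler_peMr ?(ltW n0)//.
      apply: (@le_trans _ _ (b ^- n * t)).
        rewrite mulrC ler_pdivlMr ?exprn_gt0// mul1r.
        by rewrite lerXn2r// nnegrE ltW.
      by rewrite ler_wpM2r// ltW//; exact: truncnS_gt.
    have tB := @bernoulli_ineq t m ltac:(lra).
    have prod1 : (1 - t) ^+ m * (1 + t) ^+ m <= 1.
      by rewrite -exprMn exprn_ile1//; nra.
    rewrite -[leRHS]mul1r ler_pdivlMr//.
    apply: le_trans prod1; rewrite ler_wpM2l//.
    by apply: le_trans tB; lra.
  + exact: cvg_cst.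
  + rewrite -(cvg_shiftS (fun n => n%:R^-1 : R)); exact: cvg_harmonic.
Unshelve. all: end_near. Qed.
End cutoff.

(** * Equality of measures with equal moments *)

Section moment_determinacy.
Local Open Scope classical_set_scope.
Context {R : realType}.
Implicit Types (mu : probability (measurableTypeR R) R) (M a : R).

Definition has_moments mu := forall n, mu.-integrable [set: R] (fun x : R => (x ^+ n)%:E).

Lemma measurable_normr_ge M : measurable [set x : R | M <= `|x|].
Proof.
rewrite (_ : mkset _ = (fun x => `|x|) @^-1` `[M, +oo[); last first.
  by apply/seteqP; split => x /=; rewrite in_itv/= andbT.
by rewrite -[X in measurable X]setTI; exact: normr_measurable.
Qed.

Lemma measurable_normr_gt M : measurable [set x : R | M < `|x|].
Proof.
rewrite (_ : mkset _ = (fun x => `|x|) @^-1` `]M, +oo[); last first.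
  by apply/seteqP; split => x /=; rewrite in_itv/= andbT.
by rewrite -[X in measurable X]setTI; exact: normr_measurable.
Qed.

Lemma measurable_horner (p : {poly R}) : measurable_fun [set: R] (fun x => p.[x]).
Proof.
apply: continuous_measurable_fun; exact: continuous_horner.
Qed.

Lemma integral_horner mu (p : {poly R}) : has_moments mu ->
  (\int[mu]_x (p.[x])%:E = \sum_(i < size p) (p`_i)%:E * \int[mu]_x (x ^+ i)%:E)%E.
Proof.
move=> mom.
under eq_integral => x _ do rewrite horner_coef -sumEFin.
rewrite integral_sum//=; last first.
  by move=> i; under eq_fun do rewrite EFinM; apply: integrableZl => //; exact: mom.
apply: eq_bigr => i _; under eq_integral do rewrite EFinM.
by rewrite integralZl//; exact: mom.
Qed.

Lemma integral_horner_ext mu1 mu2 (p : {poly R}) : has_moments mu1 -> has_moments mu2 ->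
  (forall n, \int[mu1]_x (x ^+ n)%:E = \int[mu2]_x (x ^+ n)%:E)%E ->
  (\int[mu1]_x (p.[x])%:E = \int[mu2]_x (p.[x])%:E)%E.
Proof.
by move=> m1 m2 e; rewrite !integral_horner//; apply: eq_bigr => i _; rewrite e.
Qed.

(** The affine map x -> (x + M) / (2 M) sends [-M, M] onto [0, 1] and a to b. Hence, off a null set,
    the composed polynomials lie between 0 and 1 and converge to the indicator of x < a, and
    dominated convergence applies with the constant 1. *)
Lemma cvg_integral_cutoff mu M a : `|a| < M -> mu [set x : R | M <= `|x|] = 0%E ->
  (\int[mu]_x (((cutoff ((a + M) / (2 * M)) n) \Po ((2 * M)^-1 *: ('X + M%:P))).[x])%:E)%E
    @[n --> \oo] --> mu `]-oo, a[.
Proof.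
move=> aM muM.
have M0 : 0 < M by rewrite (le_lt_trans _ aM).
have M20 : 0 < 2 * M by rewrite mulr_gt0.
have [aM1 aM2] : - M < a /\ a < M by move: aM; rewrite ltr_norml => /andP[].
set b := (a + M) / (2 * M).
have b01 : 0 < b <= 1.
  by rewrite divr_gt0 ?ler_pdivrMr//=; lra.
set S : set R := [set x : R | M <= `|x|].
have mS : measurable S by exact: measurable_normr_ge.
have notS x : ~ S x -> 0 <= (2 * M)^-1 * (x + M) <= 1.
  move/negP; rewrite -ltNge ltr_norml => /andP[x1 x2].
  rewrite mulrC ler_pdivrMr// divr_ge0 ?(ltW M20)//=; lra.
have comp n x : ((cutoff b n) \Po ((2 * M)^-1 *: ('X + M%:P))).[x] =
    (cutoff b n).[(2 * M)^-1 * (x + M)].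
  by rewrite horner_comp !hornerE.
pose f_ n x : \bar R := (((cutoff b n) \Po ((2 * M)^-1 *: ('X + M%:P))).[x])%:E.
pose f x : \bar R := (\1_(`]-oo, a[%classic) x)%:E.
have [] := @dominated_convergence _ _ _ mu [set: R] measurableT f_ f (cst 1%E).
- by move=> n; apply/measurable_EFinP; exact: measurable_horner.
- by apply/measurable_EFinP; exact: measurable_indic.
(* [S] serves as the exceptional null set, both for the convergence and for the bound by 1: outside
   it the rescaled point lies in [0, 1]. *)
- exists S; split => //.
  move=> x /= /not_implyP[_ ncvg]; apply: contrapT => Sx; apply: ncvg.
  have -> : f x = ((((2 * M)^-1 * (x + M)) < b)%R%:R)%:E.
    rewrite /f indicE; congr (_%:R%:E); rewrite mem_setE in_itv/= /b [_^-1 * _]mulrC.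
    by rewrite ltr_pM2r ?invr_gt0// ltrD2r.
  rewrite /f_; under eq_fun do rewrite comp; apply: cvg_EFin; first by near=> n.
  by apply: cvg_cutoff => //; exact: notS.
- apply/integrableP; split; first exact: measurable_cst.
  by under eq_integral do rewrite /= normr1; rewrite integral_cst//= probability_setT mul1e ltry.
- exists S; split => //.
  move=> x /= /existsNP[n] /not_implyP[_ nle]; apply: contrapT => Sx; apply: nle.
  rewrite /f_ comp /= lee_fin.
  by have /andP[h0 h1] := cutoff_ge0_le1 b n _ (notS _ Sx); rewrite ger0_norm.
move=> _ _; rewrite /f integral_indic// setIT; exact.
Unshelve. all: end_near. Qed.

(** Markov's inequality on even moments: N^(2n) mu2(|x| >= N) is at most the common moment of order
    2n, itself at most M^(2n). So mu2(|x| >= N) <= (M/N)^(2n), which tends to 0. *)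
Lemma moments_support mu1 mu2 M : 0 < M -> has_moments mu1 -> has_moments mu2 ->
  (forall n, \int[mu1]_x (x ^+ n)%:E = \int[mu2]_x (x ^+ n)%:E)%E ->
  mu1 [set x : R | M < `|x|] = 0%E -> forall N, M < N -> mu2 [set x : R | N <= `|x|] = 0%E.
Proof.
move=> M0 h1 h2 e muM N MN.
have N0 : 0 < N by lra.
set S : set R := [set x : R | N <= `|x|].
have mS : measurable S by exact: measurable_normr_ge.
set T : set R := [set x : R | M < `|x|] in muM.
have mT : measurable T by exact: measurable_normr_gt.
have mX n : measurable_fun [set: R] (fun x : R => (x ^+ n)%:E).
  by apply/measurable_EFinP; exact: measurable_funX.
have sqN (x : R) n : x ^+ (2 * n) = `|x| ^+ (2 * n).
  by rewrite !exprM real_normK// num_real.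
have ub n : (\int[mu1]_x (x ^+ (2 * n))%:E <= (M ^+ (2 * n))%:E)%E.
  rewrite (@negligible_integral _ _ _ mu1 [set: R] T)//.
  apply: (@le_trans _ _ (\int[mu1]_(x in setT `\` T) (M ^+ (2 * n))%:E)%E).
    apply: ge0_le_integral => //.
    - exact: measurableD.
    - by move=> x _; rewrite lee_fin sqN exprn_ge0.
    - by apply: measurable_funS (mX _).
    - move=> x [_ /negP]; rewrite /T/= -leNgt => xM.
      by rewrite lee_fin sqN lerXn2r// nnegrE ltW.
  rewrite integral_cst//=; last exact: measurableD.
  rewrite -[leRHS]mule1 lee_wpmul2l//; first by rewrite lee_fin exprn_ge0// ltW.
  by apply: probability_le1; exact: measurableD.
have lb n : ((N ^+ (2 * n))%:E * mu2 S <= \int[mu2]_x (x ^+ (2 * n))%:E)%E.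
  rewrite -integral_cst//.
  apply: (@le_trans _ _ (\int[mu2]_(x in S) (x ^+ (2 * n))%:E)%E).
    apply: ge0_le_integral => //.
    - by move=> x _; rewrite lee_fin exprn_ge0// ltW.
    - by apply: measurable_funS (mX _).
    - by move=> x Sx; rewrite lee_fin [leRHS]sqN lerXn2r// nnegrE ltW.
  apply: ge0_subset_integral => //; first exact: mX.
  by move=> x _; rewrite lee_fin sqN exprn_ge0.
have mu2S : mu2 S \is a fin_num by exact: fin_num_measure.
have key n : fine (mu2 S) <= (M / N) ^+ (2 * n).
  rewrite expr_div_n ler_pdivlMr ?exprn_gt0// mulrC -lee_fin EFinM fineK//.
  by apply: le_trans (lb n) _; rewrite -e.
apply/eqP; rewrite -(fineK mu2S) eqe eq_le fine_ge0// andbT.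
have MN0 : 0 <= M / N by rewrite divr_ge0// ltW.
have cv : ((M / N) ^+ 2) ^+ n @[n --> \oo] --> (0 : R).
  apply: cvg_expr; rewrite ger0_norm ?exprn_ge0// exprn_ilt1//.
  by rewrite ltr_pdivrMr// mul1r.
rewrite -(cvg_lim (@Rhausdorff R) cv); apply: limr_ge; first by apply/cvg_ex; exists 0.
by near=> n; rewrite -exprM; exact: key.
Unshelve. all: end_near. Qed.

(** The half-lines ]-oo, a[ are stable under intersection and generate the Borel sets. On each of
    them both measures are limits of integrals of the same polynomials, which agree because the
    moments do. *)
Lemma moments_unique mu1 mu2 M : 0 < M -> has_moments mu1 -> has_moments mu2 ->
  (forall n, \int[mu1]_x (x ^+ n)%:E = \int[mu2]_x (x ^+ n)%:E)%E ->
  mu1 [set x : R | M < `|x|] = 0%E -> forall A, measurable A -> mu1 A = mu2 A.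
Proof.
move=> M0 h1 h2 e muM.
(* Comparing [mu1] with itself turns the null set |x| > M into the null sets |x| >= N, N > M, the
   form common to both measures. *)
have supp1 := moments_support mu1 mu1 M M0 h1 h1 (fun=> erefl) muM.
have supp2 := moments_support mu1 mu2 M M0 h1 h2 e muM.
apply: (@measure_unique _ R (measurableTypeR R) (@RGenInftyO.G R)
  (fun n : nat => `]-oo, (n%:R : R)[%classic) _ _ _ _ mu1 mu2).
- exact: RGenInftyO.measurableE.
- move=> _ _ [x ->] [y ->]; exists (Num.min x y).
  apply/seteqP; split => z /=; rewrite !in_itv/= lt_min; first by case=> -> ->.
  by move=> /andP.
- by move=> n; exists n%:R.
- apply/seteqP; split => // x _; exists (Num.truncn `|x|).+1 => //=.
  by rewrite in_itv/= (le_lt_trans (ler_norm _))// truncnS_gt.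
- move=> _ [a ->].
  (* This radius exceeds M, so that both measures vanish beyond it, and |a|, so that a rescales into
     ]0, 1[. *)
  pose N := M + `|a| + 1.
  have MN : M < N by rewrite /N; have := normr_ge0 a; lra.
  have aN : `|a| < N by rewrite /N; lra.
  have c1 := cvg_integral_cutoff mu1 N a aN (supp1 _ MN).
  have c2 := cvg_integral_cutoff mu2 N a aN (supp2 _ MN).
  apply: (cvg_unique (@ereal_hausdorff R) c1).
  apply: cvg_trans c2; apply: near_eq_cvg; near=> n.
  by apply: integral_horner_ext => // k; rewrite e.
- by move=> n; rewrite (le_lt_trans (probability_le1 _ _))// ltry.
Unshelve. all: end_near. Qed.

End moment_determinacy.

(** * Probability measures with a density *)

Section density.
Local Open Scope classical_set_scope.
Local Open Scope ring_scope.
Context {R : realType}.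
Notation lebesgue := (@lebesgue_measure R).
Implicit Types (mu : probability (measurableTypeR R) R) (f g : R -> R).

(** This supplies the witness showing that the set from which [nu] is picked by [get] is
    inhabited. *)
Lemma exists_probability_density f : measurable_fun [set: R] f ->
  (forall x, 0 <= f x) -> (\int[lebesgue]_x (f x)%:E = 1)%E ->
  exists mu, is_density mu f.
Proof.
move=> mf f0 f1.
pose P (A : set (measurableTypeR R)) : \bar R := (\int[lebesgue]_(x in A) (f x)%:E)%E.
have intf : lebesgue.-integrable [set: R] (EFin \o f).
  apply/integrableP; split; first exact/measurable_EFinP.
  under eq_integral do rewrite /= ger0_norm//.
  by rewrite f1 ltry.
have P0 : P set0 = 0%E by rewrite /P integral_set0.
have Pge0 A : (0 <= P A)%E by apply: integral_ge0 => x _; rewrite lee_fin.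
have Psigma : semi_sigma_additive P.
  move=> A mA tA mUA; rewrite /P integral_bigcup//=; last exact: integrableS intf.
  by apply: is_cvg_ereal_nneg_natsum_cond => n _ _; apply: integral_ge0 => x _; rewrite lee_fin.
pose mP := isMeasure.Build _ _ R P P0 Pge0 Psigma.
pose m : {measure set (measurableTypeR R) -> \bar R} := HB.pack P mP.
pose mp := Measure_isProbability.Build _ _ R m f1.
pose mu : probability (measurableTypeR R) R := HB.pack (Measure.sort m) mp.
by exists mu; split.
Qed.

(** A measure with a density is dominated by Lebesgue measure. Its Radon-Nikodym derivative has the
    same integral as f over every measurable set, hence equals f almost everywhere, and the change
    of variables formula for that derivative carries over to f. *)
Lemma integral_density mu f (g : R -> R) : is_density mu f ->
  mu.-integrable [set: R] (EFin \o g) ->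
  (\int[mu]_x (g x)%:E = \int[lebesgue]_x (g x * f x)%:E)%E.
Proof.
move=> [mf f0 muE] ig.
have mg : measurable_fun [set: R] g by apply/measurable_EFinP; exact: measurable_int ig.
have dom : mu `<< lebesgue.
  apply/null_content_dominatesP => A mA A0; rewrite muE//.
  by apply: null_set_integral => //; apply/measurable_funTS/measurable_EFinP.
have intf : lebesgue.-integrable [set: R] (EFin \o f).
  apply/integrableP; split; first exact/measurable_EFinP.
  under eq_integral do rewrite /= ger0_norm//.
  by rewrite -muE// probability_setT ltry.
rewrite -(Radon_Nikodym_change_of_variables dom)//.
apply: ae_eq_integral => //.
- apply: emeasurable_funM; first exact/measurable_EFinP.
  by apply: (measurable_int lebesgue); exact: Radon_Nikodym_integrable.
- by apply/measurable_EFinP; exact: measurable_funM.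
- under [X in ae_eq _ _ _ X]eq_fun do rewrite EFinM.
  apply: ae_eqe_mul2l.
  apply: integral_ae_eq => //.
  + exact: Radon_Nikodym_integrable.
  + exact/measurable_EFinP.
  + by move=> E _ mE; rewrite -Radon_Nikodym_integral// -muE.
Qed.

(** If f x < g x, two levels a < b strictly between them separate f from g on a small ball B by
    continuity, so that mu(B) <= a |B| < b |B| <= mu(B). The other strict inequality is excluded by
    symmetry. *)
Lemma density_unique_at mu f g x : is_density mu f -> is_density mu g ->
  {for x, continuous f} -> {for x, continuous g} -> f x = g x.
Proof.
suff lt f1 g1 : is_density mu f1 -> is_density mu g1 ->
    {for x, continuous f1} -> {for x, continuous g1} -> ~ f1 x < g1 x.
  move=> df dg cf cg; apply/eqP; rewrite eq_le !leNgt.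
  by apply/andP; split; apply/negP; exact: lt.
move=> [mf f0 muf] [mg g0 mug] cf cg fg.
pose a := f1 x + (g1 x - f1 x) / 3.
pose b := f1 x + 2 * (g1 x - f1 x) / 3.
have fa : f1 x < a by rewrite /a; lra.
have ab : a < b by rewrite /a /b; lra.
have bg : b < g1 x by rewrite /b; lra.
have a0 : 0 <= a by apply: ltW; exact: le_lt_trans (f0 x) fa.
have /nbhs_ballP[r /= r0 hr] : \forall y \near x, f1 y < a /\ b < g1 y.
  near=> y; split; near: y.
    exact: (cvgr_lt _ cf).
  exact: (cvgr_gt _ cg).
have mB : measurable (ball x r : set R) by exact: measurable_ball.
have muB := lebesgue_measure_ball x (ltW r0).
have : (mu (ball x r) <= a%:E * (r *+ 2)%:E)%E.
  rewrite muf// -muB -integral_cst//.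
  apply: ge0_le_integral => //.
  - by move=> y _; rewrite lee_fin.
  - exact/measurable_funTS/measurable_EFinP.
  - by move=> y /hr[h _]; rewrite lee_fin ltW.
have : (b%:E * (r *+ 2)%:E <= mu (ball x r))%E.
  rewrite mug// -muB -integral_cst//.
  apply: ge0_le_integral => //.
  - by move=> y _; rewrite lee_fin (le_trans a0)// ltW.
  - exact/measurable_funTS/measurable_EFinP.
  - by move=> y /hr[_ h]; rewrite lee_fin ltW.
move=> /le_trans/[apply]; rewrite -!EFinM lee_fin ler_pM2r ?pmulrn_rgt0//.
by rewrite leNgt ab.
Unshelve. all: end_near. Qed.

Lemma has_moments_bounded_density mu f c : 0 <= c -> is_density mu f ->
  (forall x, c < `|x| -> f x = 0) -> has_moments mu /\ mu [set x : R | c < `|x|] = 0%E.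
Proof.
move=> c0 [mf f0 muE] fc.
have mS : measurable [set x : R | c < `|x|] by exact: measurable_normr_gt.
have muS : mu [set x : R | c < `|x|] = 0%E.
  by rewrite muE// integral0_eq// => x /= xc; rewrite fc.
split=> // n; apply/integrableP.
have mX : measurable_fun [set: R] (fun x : R => (x ^+ n)%:E).
  by apply/measurable_EFinP; exact: measurable_funX.
split=> //.
apply: (@le_lt_trans _ _ ((c ^+ n)%:E * mu [set: R])%E); last first.
  by rewrite probability_setT mule1 ltry.
apply: integral_le_bound => //; first by rewrite lee_fin exprn_ge0.
exists [set x : R | c < `|x|]; split=> // x /= /not_implyP[_ h].
rewrite ltNge; apply/negP => xc; apply: h.
by rewrite lee_fin normrX lerXn2r.
Qed.

(** [nu] and [V] are values of [get], which satisfy their specifications only once a witness is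
    known. The measure with density f is a witness for [nu]; by determinacy it equals [nu p r], so f
    is a witness for [V]. Two densities continuous on the open interval then agree there. *)
Lemma V_of_density (p r : R) f : 0 < cmax p ->
  measurable_fun [set: R] f -> (forall x, 0 <= f x) ->
  (forall x, cmax p < `|x| -> f x = 0) ->
  {in `]0, cmax p[, continuous f} ->
  (forall n, \int[lebesgue]_x (x ^+ n * f x)%:E = (gbinom (n%:R * p + r) n)%:E)%E ->
  {in `]0, cmax p[, V p r =1 f}.
Proof.
move=> c0 mf f0 fc cf mom x xc.
have [mu df] : exists mu, is_density mu f.
  apply: exists_probability_density => //.
  (* The total mass is the moment of order 0, and binom(r, 0) = 1. *)
  have := mom 0%N; rewrite /gbinom big_ord0 fact0 divr1 => <-.
  by apply: eq_integral => y _; rewrite expr0 mul1r.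
have [hmu muc] := has_moments_bounded_density mu f (cmax p) (ltW c0) df fc.
have bmu : has_binomial_moments p r mu.
  by move=> n; split; [exact: hmu|rewrite (integral_density mu f)//; exact: hmu].
have bnu : has_binomial_moments p r (nu p r).
  by apply: (@getPex _ [set mu | has_binomial_moments p r mu]); exists mu.
have eq_nu A : measurable A -> mu A = nu p r A.
  move=> mA; apply: (moments_unique mu (nu p r) (cmax p)) => //.
  - by move=> n; have [] := bnu n.
  - by move=> n; have [_ ->] := bmu n; have [_ ->] := bnu n.
have dnu : is_density (nu p r) f.
  by case: df => ? ? dE; split=> // A mA; rewrite -eq_nu// dE.
have [dV cV] : is_density (nu p r) (V p r) /\ {in `]0, cmax p[, continuous (V p r)}.
  exact: (@getPex _ [set g | is_density (nu p r) g /\ {in `]0, cmax p[, continuous g}]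
    (ex_intro _ f (conj dnu cf))).
by apply: (density_unique_at (nu p r)) => //; [exact: cV|exact: cf].
Qed.

End density.

(** * The moment integrals *)

Section binomial_recurrence.
Context {R : realType}.
Implicit Types (a : R) (n : nat).

Lemma gbinomS a n : gbinom a n.+1 = a / n.+1%:R * gbinom (a - 1) n.
Proof.
rewrite /gbinom big_ord_recl subr0 factS natrM.
under [in RHS]eq_bigr => i _ do rewrite -addrA -opprD nat1r.
by rewrite invfM; ring.
Qed.

(** Both sides are a (a - 1) ... (a - n) / n!, with the last factor split off on the left and the
    first one on the right. *)
Lemma gbinom_pred a n : (a - n%:R) * gbinom a n = a * gbinom (a - 1) n.
Proof.
have e : (\prod_(i < n) (a - i%:R)) * (a - n%:R) = a * \prod_(i < n) (a - 1 - i%:R).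
  under [in RHS]eq_bigr => i _ do rewrite -addrA -opprD nat1r.
  by rewrite -(@big_ord_recr _ _ _ n (fun i => a - i%:R)) big_ord_recl subr0.
by rewrite /gbinom mulrA [_ * (\prod_(i < n) _)]mulrC e mulrA.
Qed.

End binomial_recurrence.

(** * Definite integrals over [0, 1] through antiderivatives *)

Section primitive.
Context {R : realType}.
Implicit Types (h k : R -> R) (u v : R).

(** The integral of h over [0, 1] is v, certified by an antiderivative on the whole line. Linearity
    and integration by parts thereby become algebra on derivatives; [integral_primitive01] returns
    to the Lebesgue integral. *)
Definition primitive01 h v :=
  exists2 H : R -> R, (forall w : R, is_derive w (1 : R) H (h w)) & H 1 - H 0 = v.

Lemma primitive01_eq h k u v : primitive01 h u -> (forall w, h w = k w) -> u = v ->
  primitive01 k v.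
Proof.
by move=> [H dH <-] hk <-; exists H => // w; rewrite -hk.
Qed.

Lemma primitive01Z c h u : primitive01 h u -> primitive01 (fun w => c * h w) (c * u).
Proof.
move=> [H dH <-]; exists (fun w => c * H w); last by rewrite mulrBr.
move=> w; exact: (is_deriveZ c (dH w)).
Qed.

Lemma primitive01D h k u v : primitive01 h u -> primitive01 k v ->
  primitive01 (fun w => h w + k w) (u + v).
Proof.
move=> [H dH <-] [K dK <-]; exists (fun w => H w + K w); last by ring.
move=> w; exact: (is_deriveD (dH w) (dK w)).
Qed.

Lemma onepX6_gt0 (w : R) : 0 < 1 + w ^+ 6.
Proof. by rewrite ltr_wpDr// (exprM w 3 2) sqr_ge0. Qed.

Lemma is_derive_monomial m (w : R) :
  is_derive w (1 : R) (fun w => w ^+ m.+1) (m.+1%:R * w ^+ m).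
Proof.
have pE : horner ('X^(m.+1) : {poly R}) = fun w => w ^+ m.+1.
  by apply/funext => x; rewrite !hornerE.
rewrite -pE; apply: is_derive_eq (is_derive_poly _ w) _.
by rewrite derivXn hornerMn !hornerE mulr_natl.
Qed.

(** These quotients are the boundary terms of the integrations by parts. Their derivative is put
    over (1 + w^6)^(n+2), the denominator of the moment integrand of order n + 1. *)
Lemma is_derive_monomial_quotient m n (w : R) :
  is_derive w (1 : R) (fun w => w ^+ m.+1 / (1 + w ^+ 6) ^+ n.+1)
   ((m.+1%:R * w ^+ m * (1 + w ^+ 6) - 6 * n.+1%:R * w ^+ (m + 6)) / (1 + w ^+ 6) ^+ n.+2).
Proof.
have w0 : 1 + w ^+ 6 != 0 by rewrite gt_eqF// onepX6_gt0.

have dD : is_derive w (1 : R) (fun w => (1 + w ^+ 6) ^+ n.+1)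
    (n.+1%:R * (1 + w ^+ 6) ^+ n * (6 * w ^+ 5)).
  pose p : {poly R} := (1 + 'X^6) ^+ n.+1.
  have pE : horner p = fun w => (1 + w ^+ 6) ^+ n.+1 by apply/funext => x; rewrite /p !hornerE.
  rewrite -pE; apply: is_derive_eq (is_derive_poly p w) _.
  rewrite /p deriv_exp derivD derivXn derivC add0r hornerMn hornerM hornerMn !hornerE/=.
  ring.
have dN := is_derive_monomial m w.
have Dn : (1 + w ^+ 6) ^+ n.+1 != 0 by rewrite expf_neq0.
have dV : is_derive w (1 : R) (fun w => ((1 + w ^+ 6) ^+ n.+1)^-1)
    (- (n.+1%:R * (1 + w ^+ 6) ^+ n * (6 * w ^+ 5)) / ((1 + w ^+ 6) ^+ n.+1) ^+ 2).
  apply: DeriveDef; first by apply: derivableV => //; case: dD.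
  rewrite deriveV//.
  by rewrite (@derive_val _ _ _ _ _ _ _ dD) /GRing.scale/= mulrC mulrN mulNr.
apply: is_derive_eq (is_deriveM dN dV) _.
rewrite /GRing.scale/=; move: (1 + w ^+ 6) w0 => D D0.
rewrite !exprS exprD; field; rewrite ?expf_neq0 ?D0//.
Qed.


(** Since 1 + w^6 = (1 + w^2) (1 - w^2 + w^4), the integrand is 1 / (1 + w^2) + w^2 / (1 + w^6); the
    value is pi/4 + pi/12. *)
Lemma primitive01_atan : primitive01 (fun w : R => (1 + w ^+ 4) / (1 + w ^+ 6)) (pi / 3).
Proof.
exists (fun w => atan w + 3^-1 * atan (w ^+ 3)); last first.
  by rewrite expr1n expr0n /= atan0 atan1; field.
move=> w.
have d3 : is_derive w (1 : R) (fun w => w ^+ 3) (3 * w ^+ 2).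
  exact: is_derive_monomial.
have dc := @is_derive1_comp _ atan (fun w => w ^+ 3) w _ _ (is_derive1_atan _) d3.
apply: is_derive_eq (is_deriveD (is_derive1_atan w) (is_deriveZ 3^-1 dc)) _.
rewrite /GRing.scale/=.
have h6 : 1 + w ^+ 6 != 0 by rewrite gt_eqF// onepX6_gt0.
have h2 : 1 + w ^+ 2 != 0 by rewrite gt_eqF// ltr_wpDr// sqr_ge0.
by rewrite -exprM; field; rewrite h6 h2.
Qed.

(** At x = pi/6, cos (3x) = cos x (cos^2 x - 3 sin^2 x) vanishes while cos x > 0, so tan^2 x = 1/3;
    the sign of tan x settles the root. *)
Lemma tan_pi6 : tan (pi / 6) = (Num.sqrt 3)^-1 :> R.
Proof.
have pi0 := pi_gt0 R.
set x : R := pi / 6.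
have c0 : 0 < cos x by apply: cos_gt0_pihalf; rewrite /x; apply/andP; split; lra.
have s0 : 0 < sin x by apply: sin_gt0_pihalf; rewrite /x; apply/andP; split; lra.
have e : cos (x + x + x) = 0 by rewrite -cos_pihalf; congr cos; rewrite /x; field.
have := cos2Dsin2 x; have e4 : 4 * sin x ^+ 2 = 1.
  move: e; rewrite !cosD sinD => e; have := cos2Dsin2 x.
  have : cos x * (cos x ^+ 2 - 3 * sin x ^+ 2) = 0 by rewrite -[RHS]e; ring.
  move/eqP; rewrite mulf_eq0 gt_eqF//= => /eqP; lra.
move=> e1; have t0 : 0 <= tan x by rewrite /tan divr_ge0 ?ltW.
have q0 : 0 <= (Num.sqrt 3)^-1 :> R by rewrite invr_ge0 sqrtr_ge0.
apply/eqP; rewrite -(eqrXn2 (isT : (0 < 2)%N) t0 q0).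
rewrite /tan expr_div_n exprVn sqr_sqrtr//.
have -> : cos x ^+ 2 = 3 * sin x ^+ 2 by lra.
by apply/eqP; field; rewrite gt_eqF.
Qed.

Lemma atan_sqrt3V : atan (Num.sqrt 3)^-1 = pi / 6 :> R.
Proof.
have pi0 := pi_gt0 R.
by rewrite -tan_pi6 tanK// in_itv/=; apply/andP; split; lra.
Qed.

(** Cancelling 1 + w^2 leaves w / (w^4 - w^2 + 1), and 4 (w^4 - w^2 + 1) = (2 w^2 - 1)^2 + 3 leads
    to the arctangent of (2 w^2 - 1) / sqrt 3, whose argument runs from -1 / sqrt 3 to 1 / sqrt
    3. *)
Lemma primitive01_atan_sqrt3 :
  primitive01 (fun w : R => (w + w ^+ 3) / (1 + w ^+ 6)) (pi / (3 * Num.sqrt 3)).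
Proof.
set q : R := Num.sqrt 3.
have q0 : q != 0 by rewrite gt_eqF// sqrtr_gt0.
have q2 : q ^+ 2 = 3 by rewrite sqr_sqrtr.
exists (fun w => q^-1 * atan (q^-1 * (2 * w ^+ 2 - 1))); last first.
  rewrite expr1n expr0n /= mulr0 sub0r mulr1 (_ : 2 - 1 = 1); last by ring.
  by rewrite mulrN mulr1 atanN atan_sqrt3V; field.
move=> w.
have d2 : is_derive w (1 : R) (fun w => q^-1 * (2 * w ^+ 2 - 1)) (q^-1 * (4 * w)).
  have pE : horner (q^-1 *: (2 *: 'X^2 - 1)) = fun w => q^-1 * (2 * w ^+ 2 - 1).
    by apply/funext => x; rewrite !hornerE.
  rewrite -pE; apply: is_derive_eq (is_derive_poly _ w) _.
  by rewrite derivZ derivB derivZ derivXn derivC subr0 !hornerE/=; ring.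
have dc := @is_derive1_comp _ atan (fun w => q^-1 * (2 * w ^+ 2 - 1)) w _ _ (is_derive1_atan _) d2.
apply: is_derive_eq (is_deriveZ q^-1 dc) _.
rewrite /GRing.scale/=.
have h6 : 1 + w ^+ 6 != 0 by rewrite gt_eqF// onepX6_gt0.
have h3 : w ^+ 4 - w ^+ 2 + 1 != 0.
  by rewrite gt_eqF//; have := sqr_ge0 (2 * w ^+ 2 - 1); nra.
have -> : w + w ^+ 3 = w * (1 + w ^+ 2) by ring.
have -> : 1 + w ^+ 6 = (1 + w ^+ 2) * (w ^+ 4 - w ^+ 2 + 1) by ring.
have h2 : 1 + w ^+ 2 != 0 by rewrite gt_eqF// ltr_wpDr// sqr_ge0.
have -> : 1 + (q^-1 * (2 * w ^+ 2 - 1)) ^+ 2 = 4 / 3 * (w ^+ 4 - w ^+ 2 + 1).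
  by rewrite exprMn exprVn q2; field.
by rewrite mulrA mulrAC mulrA -invfM -expr2 q2; field; rewrite h2 h3.
Qed.

End primitive.

(** * Recurrences and values of the moment integrals *)

Section moment_integrals.
Context {R : realType}.
Implicit Types (v w : R) (m n : nat).

Definition moment_integrand n (e : nat) w : R :=
  w ^+ (3 * n) * (w ^+ e + w ^+ (4 - e)) / (1 + w ^+ 6) ^+ n.+1.

(** Both quotients are 0 at w = 0 and 2^-(n+1) at w = 1, so the boundary terms of their difference
    cancel and the recurrences below are homogeneous. *)
Lemma primitive01_quotient m k n : primitive01 (fun w : R =>
  (m.+1%:R * w ^+ m * (1 + w ^+ 6) - 6 * n.+1%:R * w ^+ (m + 6)) / (1 + w ^+ 6) ^+ n.+2
  - (k.+1%:R * w ^+ k * (1 + w ^+ 6) - 6 * n.+1%:R * w ^+ (k + 6)) / (1 + w ^+ 6) ^+ n.+2) 0.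
Proof.
exists (fun w => w ^+ m.+1 / (1 + w ^+ 6) ^+ n.+1 - w ^+ k.+1 / (1 + w ^+ 6) ^+ n.+1).
  move=> w; exact: (is_deriveB (is_derive_monomial_quotient m n w)
    (is_derive_monomial_quotient k n w)).
by rewrite !expr1n !expr0n /= !mul0r; ring.
Qed.

(** The boundary terms are w^(3n+5) and w^(3n+1) over (1 + w^6)^(n+1). The coefficient 3n + 1 is the
    one that cancels the terms in w^(3n) (1 + w^6), and (3n + 1) + (3n + 5) = 6 (n + 1) normalises
    what remains. *)
Lemma moment_integrand_step0 n v : primitive01 (moment_integrand n 0) v ->
  primitive01 (moment_integrand n.+1 1) ((3 * n%:R + 1) / (6 * n.+1%:R) * v).
Proof.
move=> h.
apply: primitive01_eq (primitive01D _ _ _ _ (primitive01Z ((3 * n%:R + 1) / (6 * n.+1%:R)) _ _ h)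
  (primitive01Z (6 * n.+1%:R)^-1 _ _ (primitive01_quotient (3 * n + 4) (3 * n) n))) _ _; last first.
  by rewrite mulr0 addr0.
move=> w; rewrite /moment_integrand.
have : 1 + w ^+ 6 != 0 by rewrite gt_eqF// onepX6_gt0.
rewrite mulnS [(3 + _)%N]addnC !exprD -[(3 * n + 4).+1%:R]natr1 -[(3 * n).+1%:R]natr1 (natrD _ (3 * n)%N) natrM.
rewrite (exprS (1 + _) n.+1).
have : n.+1%:R != 0 :> R by rewrite pnatr_eq0.
rewrite -natr1 => n0 D0; field.
by rewrite D0 n0 expf_neq0.
Qed.

(** Same argument with w^(3n+4) and w^(3n+2), where (3n + 2) + (3n + 4) = 6 (n + 1). *)
Lemma moment_integrand_step1 n v : primitive01 (moment_integrand n 1) v ->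
  primitive01 (moment_integrand n.+1 0) ((3 * n%:R + 2) / (6 * n.+1%:R) * v).
Proof.
move=> h.
apply: primitive01_eq (primitive01D _ _ _ _ (primitive01Z ((3 * n%:R + 2) / (6 * n.+1%:R)) _ _ h)
  (primitive01Z (6 * n.+1%:R)^-1 _ _ (primitive01_quotient (3 * n + 3) (3 * n + 1) n))) _ _; last first.
  by rewrite mulr0 addr0.
move=> w; rewrite /moment_integrand.
have : 1 + w ^+ 6 != 0 by rewrite gt_eqF// onepX6_gt0.
rewrite mulnS [(3 + _)%N]addnC !exprD -[(3 * n + 3).+1%:R]natr1 -[(3 * n + 1).+1%:R]natr1 !(natrD _ (3 * n)%N) natrM.
rewrite (exprS (1 + _) n.+1).
have : n.+1%:R != 0 :> R by rewrite pnatr_eq0.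
rewrite -natr1 => n0 D0; field.
by rewrite D0 n0 expf_neq0.
Qed.

(** The square root of 27, twice c(3/2), written so that sqrt 3 is visible to algebraic
    simplification. *)
Definition sqrt27 : R := 3 * Num.sqrt 3.

Lemma sqrt27_gt0 : 0 < sqrt27.
Proof. by rewrite mulr_gt0// sqrtr_gt0. Qed.

Lemma sqrt27_sqr : sqrt27 ^+ 2 = 27.
Proof. by rewrite exprMn sqr_sqrtr//; ring. Qed.

(** Each recurrence exchanges e = 0 and e = 1, hence the joint induction. *)
Lemma moment_integrals n :
  primitive01 (moment_integrand n 1)
    (pi / sqrt27 ^+ n.+1 * gbinom (n%:R * (3 / 2) + 0) n) /\
  primitive01 (moment_integrand n 0)
    (pi / (3 * sqrt27 ^+ n) * gbinom (n%:R * (3 / 2) - 1 / 2) n).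
Proof.
have K0 : sqrt27 != 0 by rewrite gt_eqF// sqrt27_gt0.
elim: n => [|n [IH1 IH0]].
  rewrite /gbinom !big_ord0 fact0 divr1; split.
    apply: primitive01_eq primitive01_atan_sqrt3 _ _; last by rewrite mulr1.
    by move=> w; rewrite /moment_integrand muln0 expr0 mul1r expr1 ?expr0.
  apply: primitive01_eq primitive01_atan _ _; last by rewrite !mulr1.
  by move=> w; rewrite /moment_integrand muln0 expr0 mul1r expr1 ?expr0.
have n0 : n.+1%:R != 0 :> R by rewrite pnatr_eq0.
split.
  apply: primitive01_eq (moment_integrand_step0 _ _ IH0) _ _ => //.
  (* Here the upper argument must drop twice, from 3(n+1)/2 to 3n/2 + 1/2 by [gbinomS] and then, at
     fixed n, to 3n/2 - 1/2 by [gbinom_pred]. *)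
  have := @gbinom_pred R (n.+1%:R * (3 / 2) + 0 - 1) n.
  rewrite gbinomS.
  rewrite (_ : n.+1%:R * (3 / 2) + 0 - 1 - 1 = n%:R * (3 / 2) - 1 / 2); last by rewrite -natr1; field.
  rewrite (_ : n.+1%:R * (3 / 2) + 0 - 1 - n%:R = n.+1%:R / 2); last by rewrite -natr1; field.
  set b := gbinom _ _ => e.
  have -> : b = (n.+1%:R * (3 / 2) + 0 - 1) * gbinom (n%:R * (3 / 2) - 1 / 2) n * 2 / n.+1%:R.
    by rewrite -e; field.
  rewrite (_ : sqrt27 ^+ n.+2 = 27 * sqrt27 ^+ n); last by rewrite -sqrt27_sqr -exprD.
  by move: n0; rewrite -natr1 => n0; field; rewrite n0 expf_neq0.
apply: primitive01_eq (moment_integrand_step1 _ _ IH1) _ _ => //.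
(* For r = -1/2 a single drop, from 3n/2 + 1 to 3n/2, reaches the induction hypothesis. *)
rewrite gbinomS.
rewrite (_ : n.+1%:R * (3 / 2) - 1 / 2 - 1 = n%:R * (3 / 2) + 0); last by rewrite -natr1; field.
by move: n0; rewrite -natr1 => n0; field; rewrite n0 expf_neq0.
Qed.

End moment_integrals.

(** * Substitution *)

Section substitution.
Local Open Scope classical_set_scope.
Context {R : realType}.
Notation lebesgue := (@lebesgue_measure R).

(** Dividing by n + 3 makes the left end strictly smaller than the right one already at n = 0. *)
Lemma bigcup_shrinking_itv (a b : R) : a < b ->
  \bigcup_n `[a + (b - a) / n.+3%:R, b - (b - a) / n.+3%:R] = `]a, b[.
Proof.
move=> ab; have ba : 0 < b - a by rewrite subr_gt0.
apply/seteqP; split => x /=.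
  move=> [n _ /=]; rewrite !in_itv/= => /andP[ax xb].
  have d0 : 0 < (b - a) / n.+3%:R by rewrite divr_gt0.
  move: ((b - a) / _) d0 ax xb => d d0 ax xb; by apply/andP; split; lra.
rewrite in_itv/= => /andP[ax xb].
pose e := Num.min (x - a) (b - x).
have e0 : 0 < e by rewrite lt_min !subr_gt0 ax xb.
pose n := Num.truncn ((b - a) / e).
exists n => //=; rewrite in_itv/=.
have : (b - a) / n.+3%:R <= e.
  rewrite ler_pdivrMr// mulrC -ler_pdivrMr// ltW//.
  by rewrite (lt_le_trans (truncnS_gt _))// ler_nat; exact: (leq_addl 2).
move: ((b - a) / _) => d; rewrite le_min => /andP[h1 h2]; apply/andP; split; lra.
Qed.

Lemma ge0_integration_by_substitution_oo (F f G : R -> R) (a b : R) : a < b ->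
  (forall x : R, is_derive x (1 : R) F (f x)) -> continuous f ->
  {in `]a, b[%R, forall x, 0 < f x} ->
  {in `]F a, F b[%R, continuous G} -> {in `]F a, F b[%R, forall x, 0 <= G x} ->
  (\int[lebesgue]_(x in `]F a, F b[) (G x)%:E =
   \int[lebesgue]_(x in `]a, b[) (G (F x) * f x)%:E)%E.
Proof.
move=> ab dF cf f0 cG G0.
have ba : 0 < b - a by rewrite subr_gt0.
have F'E : F^`()%classic = f.
  by apply/funext => x; rewrite derive1E; exact: (@derive_val _ _ _ _ _ _ _ (dF x)).
have derF x : derivable F x 1 by case: (dF x).
have cF : continuous F.
  by move=> x; apply/differentiable_continuous/derivable1_diffP.
have wcF (c d : R) : {within `[c, d], continuous F} by exact: continuous_subspaceT.
have homoF : {in `[a, b]%R &, {homo F : x y / x < y}}.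
  apply: gtr0_derive1_lt_cc => // x xab; rewrite F'E; exact: f0.
pose d n : R := (b - a) / n.+3%:R.
pose u n := a + d n; pose v n := b - d n.
have dn n : 0 < d n by rewrite divr_gt0.
have d2 n : d n < (b - a) / 2 by rewrite /d ltr_pM2l// ltf_pV2 ?posrE// ltr_nat.
have dS m n : (m <= n)%N -> d n <= d m.
  by move=> mn; rewrite /d ler_pM2l// lef_pV2 ?posrE// ler_nat.
have uv n : [/\ a < u n, u n < v n & v n < b].
  by have := dn n; have := d2 n; rewrite /u /v; split; lra.
have uab n : u n \in `[a, b]%R by have [? ? ?] := uv n; rewrite in_itv/=; apply/andP; split; lra.
have vab n : v n \in `[a, b]%R by have [? ? ?] := uv n; rewrite in_itv/=; apply/andP; split; lra.
have aab : a \in `[a, b]%R by rewrite in_itv/= lexx ltW.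
have bab : b \in `[a, b]%R by rewrite in_itv/= lexx ltW.
have Fuv n : [/\ F a < F (u n), F (u n) < F (v n) & F (v n) < F b].
  by have [? ? ?] := uv n; split; apply: homoF.
have homoFle : {in `[a, b]%R &, {homo F : x y / x <= y}}.
  by move=> x y xab yab; rewrite !le_eqVlt => /predU1P[->|/(homoF _ _ xab yab) ->];
    rewrite ?eqxx ?orbT.
have mG : measurable_fun `]F a, F b[ (fun x => (G x)%:E).
  apply/measurable_EFinP; apply: open_continuous_measurable_fun; first exact: interval_open.
  by move=> x; rewrite inE/= => xF; exact: cG.
have FE x : x \in `]a, b[%R -> F x \in `]F a, F b[%R.
  move=> xab; have xab' : x \in `[a, b]%R by exact: subset_itv_oo_cc.
  move: xab; rewrite !in_itv/= => /andP[ax xb].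
  by rewrite !homoF.
have cGF : {in `]a, b[%R, continuous (fun x => G (F x) * f x)}.
  move=> x xab; apply: cvgM; last exact: cf.
  by apply: continuous_comp; [exact: cF|exact/cG/FE].
have mGF : measurable_fun `]a, b[ (fun x => (G (F x) * f x)%:E).
  apply/measurable_EFinP; apply: open_continuous_measurable_fun; first exact: interval_open.
  by move=> x; rewrite inE/= => xF; exact: cGF.
have step n : (\int[lebesgue]_(x in `[F (u n), F (v n)]) (G x)%:E =
   \int[lebesgue]_(x in `[u n, v n]) (G (F x) * f x)%:E)%E.
  have [au unv vb] := uv n; have [Fau Fuvn Fvb] := Fuv n.
  rewrite integration_by_substitution_increasing ?(ltW unv)//.
  - by apply: eq_integral => x _; rewrite F'E.
  - move=> x y; rewrite !in_itv/= => /andP[x1 x2] /andP[y1 y2]; apply: homoF; rewrite in_itv/=; apply/andP; split; lra.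
  - by rewrite F'E => x _; exact: cf.
  - by rewrite F'E; apply: (cvgP (f (u n))); apply: cvg_at_right_filter; exact: cf.
  - by rewrite F'E; apply: (cvgP (f (v n))); apply: cvg_at_left_filter; exact: cf.
  - split; first by move=> x _; exact: derF.
      by apply: cvg_at_right_filter; exact: cF.
    by apply: cvg_at_left_filter; exact: cF.
  - apply: continuous_in_subspaceT => x; rewrite inE/= in_itv/= => /andP[x1 x2].
    by apply: cG; rewrite in_itv/= (lt_le_trans Fau)//= (le_lt_trans x2).
have subF n : `[F (u n), F (v n)] `<=` `]F a, F b[.
  by have [? ? ?] := Fuv n; apply: subset_itvSoo; rewrite bnd_simp.
have sub n : `[u n, v n] `<=` `]a, b[.
  by have [? ? ?] := uv n; apply: subset_itvSoo; rewrite bnd_simp.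
have cupF : \bigcup_n `[F (u n), F (v n)] = `]F a, F b[.
  apply/seteqP; split => [x [n _]|y /=]; first exact: subF.
  rewrite in_itv/= => /andP[ay yb].
  (* The preimage of y given by the intermediate value theorem is not an end of [a, b], since y is
     neither F a nor F b; it thus lies in one of the compact intervals. *)
  have [|w wab Fw] := @IVT _ F a b y (ltW ab) (wcF a b).
    by rewrite (min_l (ltW (lt_trans ay yb))) (max_r (ltW (lt_trans ay yb))) (ltW ay) (ltW yb).
  have : w \in `]a, b[.
    rewrite inE/= in_itv/= !lt_neqAle; move: wab; rewrite in_itv/= => /andP[-> ->].
    rewrite !andbT; apply/andP; split; apply/eqP => e; move: ay yb; rewrite -Fw.
      by rewrite e ltxx.
    by rewrite e ltxx.
  rewrite inE -bigcup_shrinking_itv// => -[n _ wn]; exists n => //=.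
  have wuv : u n <= w <= v n by move: wn; rewrite /= in_itv.
  by move/andP: wuv => [? ?]; rewrite in_itv/= -Fw !homoFle.
have cvF : (\int[lebesgue]_(x in `[F (u n), F (v n)]) (G x)%:E)%E @[n --> \oo] -->
    (\int[lebesgue]_(x in `]F a, F b[) (G x)%:E)%E.
  rewrite -cupF; apply: ge0_nondecreasing_set_cvg_integral => //.
  - move=> m n mn; rewrite subsetEset; apply: subset_itvScc; rewrite bnd_simp;
      apply: homoFle => //; have := dS _ _ mn; rewrite /u /v; lra.
  - by move=> n; apply: measurable_funS mG => //; exact: subF.
  - by move=> n x /subF xF; rewrite lee_fin; exact: G0.
have cv : (\int[lebesgue]_(x in `[u n, v n]) (G (F x) * f x)%:E)%E @[n --> \oo] -->
    (\int[lebesgue]_(x in `]a, b[) (G (F x) * f x)%:E)%E.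
  rewrite -(bigcup_shrinking_itv _ _ ab); apply: ge0_nondecreasing_set_cvg_integral => //.
  - move=> m n mn; rewrite subsetEset; apply: subset_itvScc; rewrite bnd_simp;
      have := dS _ _ mn; rewrite /u /v; lra.
  - by move=> n; apply: measurable_funS mGF => //; exact: sub.
  - move=> n x /sub xab; rewrite lee_fin mulr_ge0//; first exact/G0/FE.
    by apply: ltW; exact: f0.
apply: (cvg_unique (@ereal_hausdorff R) cvF).
by apply: cvg_trans cv; apply: near_eq_cvg; near=> n; rewrite step.
Unshelve. all: end_near. Qed.

Lemma integral_primitive01 (h : R -> R) v : continuous h -> primitive01 h v ->
  (\int[lebesgue]_(x in `]0%R, 1%R[) (h x)%:E = v%:E)%E.
Proof.
move=> ch [H dH <-].
have derH x : derivable H x 1 by case: (dH x).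
have cH : continuous H.
  by move=> x; apply/differentiable_continuous/derivable1_diffP.
rewrite -(@integral_itv_bndoo _ _ _ _ true false); last first.
  by apply/measurable_EFinP; apply: measurable_funTS; exact: continuous_measurable_fun.
rewrite (@continuous_FTC2 _ h H)//.
- exact: continuous_subspaceT.
- split; first by move=> x _.
    by apply: cvg_at_right_filter; exact: cH.
  by apply: cvg_at_left_filter; exact: cH.
- by move=> x _; rewrite derive1E; exact: (@derive_val _ _ _ _ _ _ _ (dH x)).
Qed.

End substitution.

(** * The densities for p = 3/2 *)

Section raney_density.
Local Open Scope classical_set_scope.
Context {R : realType}.
Notation lebesgue := (@lebesgue_measure R).
Notation K := (@sqrt27 R).
Implicit Types (k x w : R) (j n : nat).

Definition zvar x : R := 4 * x ^+ 2 / 27.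
Definition svar x : R := 1 + Num.sqrt (1 - zvar x).

(* r = 0 is (k, j) = (3 pi, 1) and r = -1/2 is (k, j) = (3 pi sqrt 3, 2). *)
Definition raney_formula k j x : R :=
  (svar x `^ (j%:R / 3) * zvar x `^ (- (j%:R / 6)) +
   svar x `^ (- (j%:R / 3)) * zvar x `^ (j%:R / 6)) / (k * Num.sqrt (1 - zvar x)).

Definition raney_density k j : R -> R := raney_formula k j \_ `]0, K / 2[.

(* The exponent 1 and the factor 1 below keep the shape of
   [is_derive_monomial_quotient] for m = 2 and n = 0. *)
Definition raney_param w : R := K * (w ^+ 3 / (1 + w ^+ 6) ^+ 1).

Definition raney_param' w : R :=
  K * ((3 * w ^+ 2 * (1 + w ^+ 6) - 6 * 1 * w ^+ (2 + 6)) / (1 + w ^+ 6) ^+ 2).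

Lemma raney_param0 : raney_param 0 = 0.
Proof. by rewrite /raney_param expr0n/= mul0r mulr0. Qed.

Lemma raney_param1 : raney_param 1 = K / 2.
Proof. by rewrite /raney_param !expr1n div1r. Qed.

Lemma is_derive_raney_param w : is_derive w (1 : R) raney_param (raney_param' w).
Proof. exact: (is_deriveZ K (is_derive_monomial_quotient 2 0 w)). Qed.

Lemma raney_param'_gt0 w : 0 < w < 1 -> 0 < raney_param' w.
Proof.
move=> /andP[w0 w1]; rewrite mulr_gt0 ?sqrt27_gt0// divr_gt0 ?exprn_gt0 ?onepX6_gt0//.
rewrite (_ : _ - _ = 3 * w ^+ 2 * (1 - w ^+ 6)); last by ring.
by rewrite !mulr_gt0 ?exprn_gt0// subr_gt0 exprn_ilt1// ltW.
Qed.

Lemma continuous_over_onepX6 (p : {poly R}) n :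
  continuous (fun w : R => p.[w] / (1 + w ^+ 6) ^+ n).
Proof.
move=> w; apply: cvgM; first exact: continuous_horner.
pose q : {poly R} := (1 + 'X^6) ^+ n.
have qE : horner q = fun w => (1 + w ^+ 6) ^+ n by apply/funext => y; rewrite /q !hornerE.
apply: cvgV; first by rewrite gt_eqF// exprn_gt0// onepX6_gt0.
have cq : continuous (fun w : R => (1 + w ^+ 6) ^+ n) by rewrite -qE; exact: continuous_horner.
exact: cq.
Qed.

Lemma continuous_raney_param' : continuous raney_param'.
Proof.
pose p : {poly R} := K *: (3 *: 'X^2 * (1 + 'X^6) - 6 *: 'X^8).
rewrite (_ : raney_param' = fun w => p.[w] / (1 + w ^+ 6) ^+ 2).
  exact: continuous_over_onepX6.
by apply/funext => w; rewrite /raney_param' /p mulrA !hornerE/=; congr (_ / _); ring.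
Qed.

Lemma continuous_moment_integrand n e : continuous (@moment_integrand R n e).
Proof.
pose p : {poly R} := 'X^(3 * n) * ('X^e + 'X^(4 - e)).
rewrite (_ : moment_integrand n e = fun w => p.[w] / (1 + w ^+ 6) ^+ n.+1).
  exact: continuous_over_onepX6.
by apply/funext => w; rewrite /moment_integrand /p !hornerE.
Qed.

Lemma zvar_gt0_lt1 x : 0 < x < K / 2 -> 0 < zvar x < 1.
Proof.
move=> /andP[x0 xK].
rewrite /zvar divr_gt0 ?mulr_gt0 ?exprn_gt0//= ltr_pdivrMr// mul1r.
have : x ^+ 2 < (K / 2) ^+ 2 by rewrite ltrXn2r// ?nnegrE ltW.
by rewrite expr_div_n sqrt27_sqr => h; lra.
Qed.

Lemma raney_formula_ge0 k j x : 0 < k -> 0 <= raney_formula k j x.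
Proof.
move=> k0; rewrite divr_ge0// ?mulr_ge0 ?sqrtr_ge0 ?(ltW k0)//.
by rewrite addr_ge0// mulr_ge0// powR_ge0.
Qed.

Lemma raney_density_ge0 k j x : 0 < k -> 0 <= raney_density k j x.
Proof. by move=> k0; rewrite /raney_density patchE; case: ifP => // _; exact: raney_formula_ge0. Qed.

Lemma continuous_powR_comp (f : R -> R) a x : {for x, continuous f} -> 0 < f x ->
  {for x, continuous (fun y => f y `^ a)}.
Proof.
move=> cf fx0; apply: (@continuous_comp _ _ _ f (fun y => y `^ a)); first exact: cf.
apply/differentiable_continuous/derivable1_diffP.
by apply: derivable_powR; rewrite in_itv/= fx0.
Qed.

Lemma continuous_raney_formula k j : k != 0 ->
  {in `]0, K / 2[%R, continuous (raney_formula k j)}.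
Proof.
move=> k0 x; rewrite in_itv/= => /zvar_gt0_lt1/andP[z0 z1].
have cz : {for x, continuous zvar}.
  have -> : zvar = horner ((4 / 27) *: 'X^2).
    by apply/funext => y; rewrite /zvar hornerZ hornerXn; field.
  exact: continuous_horner.
have cq : {for x, continuous (fun y => Num.sqrt (1 - zvar y))}.
  apply: continuous_comp; last exact: sqrt_continuous.
  by apply: cvgB; [exact: cvg_cst|exact: cz].
have cs : {for x, continuous svar} by apply: cvgD; [exact: cvg_cst|exact: cq].
have s0 : 0 < svar x by rewrite ltr_wpDr// sqrtr_ge0.
have q0 : 0 < Num.sqrt (1 - zvar x) by rewrite sqrtr_gt0 subr_gt0.
apply: cvgM; last first.
  apply: cvgV; first by rewrite mulf_neq0// gt_eqF.
  by apply: cvgM; [exact: cvg_cst|exact: cq].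
by apply: cvgD; apply: cvgM; exact: continuous_powR_comp.
Qed.

Lemma continuous_raney_density k j : k != 0 ->
  {in `]0, K / 2[%R, continuous (raney_density k j)}.
Proof.
move=> k0 x xK.
have e y : y \in `]0, K / 2[%R -> raney_formula k j y = raney_density k j y.
  by move=> yK; rewrite /raney_density patchE mem_setE yK.
rewrite /continuous_at -(e _ xK).
apply: cvg_trans (continuous_raney_formula k j k0 _ xK); apply: near_eq_cvg.
by near=> y; apply: e; near: y; exact: near_in_itvoo.
Unshelve. all: end_near. Qed.

Lemma measurable_raney_density k j : k != 0 -> measurable_fun [set: R] (raney_density k j).
Proof.
move=> k0; rewrite /raney_density; apply/(measurable_restrictT (D := `]0, K / 2[)); first exact: measurable_itv.
apply: open_continuous_measurable_fun; first exact: interval_open.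
by move=> x; rewrite inE/=; exact: continuous_raney_formula.
Qed.

(** With q = sqrt z = 2 w^3 / (1 + w^6), one has s = w^-3 q, so the powers of q cancel and s^(j/3)
    z^(-j/6) = w^-j; the other term is its inverse. The factor 1 - w^6 of sqrt (1 - z) cancels
    against that of the derivative 3 K w^2 (1 - w^6) / (1 + w^6)^2. *)
Lemma raney_formula_param k j w : k != 0 -> (j <= 2)%N -> 0 < w < 1 ->
  raney_formula k j (raney_param w) * raney_param' w =
  3 * K / k * ((w ^+ (2 - j) + w ^+ (2 + j)) / (1 + w ^+ 6)).
Proof.
move=> k0 j2 /andP[w0 w1].
have D0 := onepX6_gt0 w.
have Dn0 : 1 + w ^+ 6 != 0 by rewrite gt_eqF.
have wn0 : w != 0 by rewrite gt_eqF.
have w61 : w ^+ 6 < 1 by rewrite exprn_ilt1// ltW.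
pose q := 2 * w ^+ 3 / (1 + w ^+ 6).
have q0 : 0 < q by rewrite divr_gt0// mulr_gt0// exprn_gt0.
have zE : zvar (raney_param w) = q ^+ 2.
  by rewrite /zvar /raney_param expr1 exprMn sqrt27_sqr /q; field.
have sqE : Num.sqrt (1 - q ^+ 2) = (1 - w ^+ 6) / (1 + w ^+ 6).
  rewrite (_ : 1 - q ^+ 2 = ((1 - w ^+ 6) / (1 + w ^+ 6)) ^+ 2); last by rewrite /q; field.
  by rewrite sqrtr_sqr ger0_norm// divr_ge0 ?(ltW D0)// subr_ge0 ltW.
have sE : svar (raney_param w) = w ^- 3 * q.
  by rewrite /svar zE sqE /q; field; rewrite wn0 Dn0.
have zpow a : (q ^+ 2) `^ a = q `^ (2 * a).
  by rewrite -(powR_mulrn 2 (ltW q0)) -powRrM.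
have wpow : (w ^- 3) `^ (j%:R / 3) = w ^- j.
  rewrite -(powR_invn 3 (ltW w0)) -powRrM mulNr mulrC divfK ?pnatr_eq0//.
  by rewrite powR_invn// ltW.
have qq a : q `^ (- a) * q `^ a = 1.
  by rewrite powRN mulVf// gt_eqF// powR_gt0.
have w3 : 0 <= w ^- 3 by rewrite invr_ge0 exprn_ge0// ltW.
have fE : raney_formula k j (raney_param w) =
    (w ^- j + w ^+ j) / (k * ((1 - w ^+ 6) / (1 + w ^+ 6))).
  rewrite /raney_formula zE sE sqE !zpow mulrN.
  rewrite (_ : 2 * (j%:R / 6) = j%:R / 3); last by field.
  rewrite [(w ^- 3 * q) `^ (- _)]powRN powRM// ?(ltW q0)//.
  rewrite wpow -mulrA [q `^ _ * _]mulrC qq mulr1.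
  by rewrite invfM -mulrA -powRN qq mulr1 invrK.
rewrite fE /raney_param'.
(* The bound j <= 2 makes the subtraction of naturals an honest one. *)
have -> : w ^- j = w ^+ (2 - j) / w ^+ 2.
  by rewrite -{2}(subnK j2) exprD invfM mulrA divff ?mul1r// expf_neq0.
rewrite !exprD; field.
by rewrite k0 wn0 Dn0 subr_eq0 gt_eqF.
Qed.

(** After the substitution x^n contributes K^n w^(3n) / (1 + w^6)^n. The exponents 2 - j and 2 + j
    are e and 4 - e. *)
Lemma raney_density_moment k j n v : k != 0 -> 0 < k -> (j <= 2)%N ->
  primitive01 (moment_integrand n (2 - j)) v ->
  (\int[lebesgue]_x (x ^+ n * raney_density k j x)%:E = (3 * K ^+ n.+1 / k * v)%:E)%E.
Proof.
move=> kn0 k0 j2 hv.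
transitivity (\int[lebesgue]_(x in `]raney_param 0, raney_param 1[)
    (x ^+ n * raney_formula k j x)%:E)%E.
  rewrite raney_param0.
  rewrite ?raney_param1.
  rewrite [RHS]integral_mkcond; apply: eq_integral => x _.
  by rewrite /raney_density !patchE; case: ifP => //; rewrite mulr0.
have pos : {in `]0, 1[%R, forall w, 0 < raney_param' w}.
  by move=> w; rewrite in_itv/=; exact: raney_param'_gt0.
have cG : {in `]raney_param 0, raney_param 1[%R,
    continuous (fun x => x ^+ n * raney_formula k j x)}.
  rewrite raney_param0 raney_param1 => x xK.
  apply: cvgM; last exact: continuous_raney_formula.
  exact: exprn_continuous.
have G0 : {in `]raney_param 0, raney_param 1[%R,
    forall x, 0 <= x ^+ n * raney_formula k j x}.
  rewrite raney_param0 => x; rewrite in_itv/= => /andP[x0 _].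
  by rewrite mulr_ge0 ?exprn_ge0 ?(ltW x0)//; exact: raney_formula_ge0.
have -> := ge0_integration_by_substitution_oo _ _ _ _ _ ltr01 is_derive_raney_param
  continuous_raney_param' pos cG G0.
have cM : continuous (fun w => 3 * K ^+ n.+1 / k * moment_integrand n (2 - j) w).
  by move=> w; apply: cvgM; [exact: cvg_cst|exact: continuous_moment_integrand].
rewrite -(integral_primitive01 _ _ cM (primitive01Z (3 * K ^+ n.+1 / k) _ _ hv)).
apply: eq_integral => w; rewrite inE/= in_itv/= => w01; congr (_%:E).
rewrite -mulrA raney_formula_param// /moment_integrand /raney_param expr1.
rewrite (_ : 4 - (2 - j) = 2 + j)%N; last by move: j2; case: (j) => [|[|[]]].
rewrite exprMn expr_div_n -exprM (exprS _ n) (exprS _ n).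
have D0 : 1 + w ^+ 6 != 0 by rewrite gt_eqF// onepX6_gt0.
by field; rewrite kn0 D0 expf_neq0.
Qed.

End raney_density.

(** * Evaluation of the three densities *)

Section raney_values.
Context {R : realType}.
Notation K := (@sqrt27 R).
Implicit Types (k x : R) (j n : nat).

Lemma sqrt_27_4 : Num.sqrt (27 / 4) = K / 2.
Proof.
rewrite (_ : 27 / 4 = (K / 2) ^+ 2); last by rewrite expr_div_n sqrt27_sqr; field.
by rewrite sqrtr_sqr ger0_norm// divr_ge0// ltW// sqrt27_gt0.
Qed.

(** Here c(3/2) = (3/2) sqrt (3/2) sqrt 2, by splitting the exponent 3/2 as 1 + 1/2. *)
Lemma cmax_3_2 : cmax (3 / 2 : R) = K / 2.
Proof.
rewrite /cmax -sqrt_27_4.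
rewrite (_ : 1 - 3 / 2 = - 2^-1); last by field.
rewrite (_ : 3 / 2 - 1 = 2^-1 :> R); last by field.
rewrite powRN powR12_sqrt// -sqrtrV//.
rewrite {2}(_ : 3 / 2 = 1 + 2^-1 :> R); last by field.
rewrite powRD; last by apply/implyP => _; rewrite gt_eqF.
rewrite powRr1// powR12_sqrt// -mulrA -sqrtrM// -[X in X * _](@ger0_norm _ (3 / 2))//.
by rewrite -sqrtr_sqr -sqrtrM ?sqr_ge0//; congr Num.sqrt; field.
Qed.

Lemma raney_density_out k j x : K / 2 < `|x| -> raney_density k j x = 0.
Proof.
move=> xK; rewrite /raney_density patchE mem_setE in_itv/=.
case: ifP => // /andP[x0 x1]; move: xK; rewrite gtr0_norm//; lra.
Qed.

Lemma raney_density_neg k j x : x < 0 -> raney_density k j x = 0.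
Proof. by move=> x0; rewrite /raney_density patchE mem_setE in_itv/= ltNge (ltW x0). Qed.

Lemma raney_densityE k j x : 0 < x < K / 2 -> raney_density k j x = raney_formula k j x.
Proof. by move=> xK; rewrite /raney_density patchE mem_setE in_itv/= xK. Qed.

Let pi_neq0 : pi != 0 :> R. Proof. by rewrite gt_eqF// pi_gt0. Qed.
Let pi3 : 0 < 3 * pi :> R. Proof. by rewrite mulr_gt0// pi_gt0. Qed.
Let pi33 : 0 < 3 * pi * Num.sqrt 3 :> R. Proof. by rewrite mulr_gt0// sqrtr_gt0. Qed.

Lemma V_3_2_Nhalf x : 0 < x < K / 2 ->
  V (3 / 2) (- (1 / 2)) x = raney_formula (3 * pi * Num.sqrt 3) 2 x.
Proof.
move=> xK; rewrite -raney_densityE//.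
have k0 : 3 * pi * Num.sqrt 3 != 0 :> R by rewrite gt_eqF.
apply: V_of_density; rewrite ?cmax_3_2 ?divr_gt0 ?sqrt27_gt0//.
- exact: measurable_raney_density.
- by move=> y; exact: raney_density_ge0.
- exact: raney_density_out.
- exact: continuous_raney_density.
- move=> n; have [_ h] := @moment_integrals R n.
  rewrite (raney_density_moment _ 2 _ _ k0 pi33 _ h)//; congr (_%:E).
  (* The choice k = 3 pi sqrt 3 makes the constant 3 K^(n+1) / k times pi / (3 K^n) equal to 1. *)
  rewrite mulrA -[RHS]mul1r; congr (_ * _).
  have q0 : Num.sqrt 3 != 0 :> R by rewrite gt_eqF// sqrtr_gt0.
  have Kn0 : K ^+ n != 0 by rewrite expf_neq0// gt_eqF// sqrt27_gt0.
  rewrite exprS {1}/sqrt27; move: (K ^+ n) Kn0 (@pi R) pi_neq0 => Kn Kn0 P P0.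
  by field; rewrite Kn0 q0 P0.
Qed.

Lemma integral_raney_density_1 n :
  (\int[@lebesgue_measure R]_x (x ^+ n * raney_density (3 * pi) 1 x)%:E =
   (gbinom (n%:R * (3 / 2) + 0) n)%:E)%E.
Proof.
have k0 : 3 * pi != 0 :> R by rewrite gt_eqF.
have [h _] := @moment_integrals R n.
rewrite (raney_density_moment _ 1 _ _ k0 pi3 _ h)//; congr (_%:E).
rewrite mulrA -[RHS]mul1r; congr (_ * _).
move: (@pi R) pi_neq0 => P P0; field.
by rewrite P0 expf_neq0// gt_eqF// sqrt27_gt0.
Qed.

Lemma V_3_2_0 x : 0 < x < K / 2 -> V (3 / 2) 0 x = raney_formula (3 * pi) 1 x.
Proof.
move=> xK; rewrite -raney_densityE//.
have k0 : 3 * pi != 0 :> R by rewrite gt_eqF.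
apply: V_of_density; rewrite ?cmax_3_2 ?divr_gt0 ?sqrt27_gt0//.
- exact: measurable_raney_density.
- by move=> y; exact: raney_density_ge0.
- exact: raney_density_out.
- exact: continuous_raney_density.
- exact: integral_raney_density_1.
Qed.

Lemma V_3_2_half x : 0 < x < K / 2 ->
  V (3 / 2) (1 / 2) x = 2 / 3 * x * raney_formula (3 * pi) 1 x.
Proof.
move=> xK; rewrite -raney_densityE//.
have k0 : 3 * pi != 0 :> R by rewrite gt_eqF.
pose f y : R := 2 / 3 * y * raney_density (3 * pi) 1 y.
rewrite -[RHS]/(f x).
have mf : measurable_fun [set: R] f.
  by apply: measurable_funM; [exact: measurable_funM|exact: measurable_raney_density].
apply: V_of_density => //; rewrite ?cmax_3_2 ?divr_gt0 ?sqrt27_gt0//.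
(* The linear factor is negative for y < 0, but the density vanishes there. *)
- move=> y; rewrite /f; have [y0|y0] := leP 0 y.
    by rewrite mulr_ge0 ?mulr_ge0// raney_density_ge0.
  by rewrite raney_density_neg ?mulr0.
- by move=> y yK; rewrite /f raney_density_out// mulr0.
- move=> y yK; apply: cvgM; last exact: continuous_raney_density.
  by apply: cvgM; [exact: cvg_cst|exact: cvg_id].
- move=> n.
  have mom := integral_raney_density_1 n.+1.
  transitivity ((2 / 3)%:E *
      \int[@lebesgue_measure R]_y (y ^+ n.+1 * raney_density (3 * pi) 1 y)%:E)%E.
    rewrite -ge0_integralZl//=.
    - by apply: eq_integral => y _; rewrite -EFinM /f exprS; congr (_%:E); ring.
    - apply/measurable_EFinP; apply: measurable_funM; first exact: measurable_funX.
      exact: measurable_raney_density.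
    - move=> y _; rewrite lee_fin; have [y0|y0] := leP 0 y.
        by rewrite mulr_ge0 ?exprn_ge0// raney_density_ge0.
      by rewrite raney_density_neg ?mulr0.
  (* With a = 3(n+1)/2, the factor (2/3) a / (n + 1) is 1, which leaves binom(a - 1, n). *)
  rewrite mom -EFinM gbinomS addr0; congr (_%:E).
  rewrite (_ : n.+1%:R * (3 / 2) - 1 = n%:R * (3 / 2) + 1 / 2); last by rewrite -natr1; field.
  have : n.+1%:R != 0 :> R by rewrite pnatr_eq0.
  by move: (n.+1%:R : R) (gbinom _ _) => m b m0; field.
Qed.

End raney_values.

Theorem theorem5p2 (R : realType) (x : R)
    (hx : 0 < x < Num.sqrt (27 / 4)) :
  let z : R := 4 * x ^+ 2 / 27 in
  let s : R := 1 + Num.sqrt (1 - z) in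
  [/\ V (3 / 2) (- (1 / 2)) x =
        s `^ (2 / 3) / (3 * pi * Num.sqrt (3 * (1 - z))) * z `^ (- (1 / 3))
        + s `^ (- (2 / 3)) / (3 * pi * Num.sqrt (3 * (1 - z))) * z `^ (1 / 3),
      V (3 / 2) 0 x =
        s `^ (1 / 3) / (3 * pi * Num.sqrt (1 - z)) * z `^ (- (1 / 6))
        + s `^ (- (1 / 3)) / (3 * pi * Num.sqrt (1 - z)) * z `^ (1 / 6) &
      V (3 / 2) (1 / 2) x =
        s `^ (1 / 3) / (pi * Num.sqrt (3 * (1 - z))) * z `^ (1 / 3)
        + s `^ (- (1 / 3)) / (pi * Num.sqrt (3 * (1 - z))) * z `^ (2 / 3)].
Proof.
move: hx; rewrite sqrt_27_4 => xK z s.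
have /andP[x0 _] := xK.
have /andP[z0 z1] : 0 < z < 1 := zvar_gt0_lt1 x xK.
have r0 : Num.sqrt (1 - z) != 0 by rewrite gt_eqF// sqrtr_gt0 subr_gt0.
have q0 : Num.sqrt 3 != 0 :> R by rewrite gt_eqF// sqrtr_gt0.
have sq31 : Num.sqrt (3 * (1 - z)) = Num.sqrt 3 * Num.sqrt (1 - z) by rewrite sqrtrM.
rewrite V_3_2_Nhalf// V_3_2_0// V_3_2_half// /raney_formula -/(svar x) -/s -/z sq31.
rewrite (_ : 2%:R / 6 = 1 / 3 :> R); last by field.
have : pi != 0 :> R by rewrite gt_eqF// pi_gt0.
move: (@pi R) => P p0; split.
- by field; rewrite r0 q0 p0.
- by field; rewrite r0 p0.
(* Since sqrt z = 2 x / sqrt 27, the factor x of this density raises the exponents -1/6 and 1/6 of z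
   by 1/2, to 1/3 and 2/3. *)
- have zh a : z `^ (a + 2^-1) = z `^ a * (2 * x / sqrt27).
    rewrite powRD; last by apply/implyP => _; rewrite gt_eqF.
    rewrite powR12_sqrt ?(ltW z0)//; congr (_ * _).
    rewrite (_ : z = (2 * x / sqrt27) ^+ 2); last by rewrite expr_div_n sqrt27_sqr /z; field.
    by rewrite sqrtr_sqr ger0_norm// divr_ge0 ?mulr_ge0 ?ltW// sqrt27_gt0.
  rewrite (_ : 2 / 3 = 1 / 6 + 2^-1 :> R); last by field.
  rewrite [in RHS](_ : z `^ (1 / 3) = z `^ (- (1 / 6) + 2^-1)); last by congr (_ `^ _); field.
  rewrite !zh /sqrt27.
  have : Num.sqrt 3 ^+ 2 = 3 :> R by rewrite sqr_sqrtr.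
  move: (Num.sqrt 3) q0 => q q0 q2.
  (* The two sides agree only through q^2 = 3: the middle form carries q^2, replaced by 3 for the
     first equality and matched with two factors q for the second. *)
  transitivity (2 * x / (3 * P * Num.sqrt (1 - z) * q ^+ 2) *
      (s `^ (1 / 3) * z `^ (- (1 / 6)) + s `^ (- (1 / 3)) * z `^ (1 / 6))).
    by rewrite q2; field; rewrite r0 p0.
  by field; rewrite r0 q0 p0.
Qed.
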